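(* Let $\mathcal{Q}=(Q,\&)$ be a quantale and let $\Phi$ be a class of weights that is a subclass of flat ideals (i.e. every element of $\Phi(A)$ is a flat ideal of $A$, for every $\mathcal{Q}$-ordered set $A$). Then for each $\Phi$-cocontinuous map $f:A\to B$ between $\mathcal{Q}$-ordered sets, $f:(A,\sigma_\Phi(A))\to(B,\sigma_\Phi(B))$ is continuous.
   Context: A quantale $\mathcal{Q}=(Q,\&)$ is always assumed integral and commutative: $Q$ is a complete lattice (bottom $0$, top $1$) and $\&$ is a commutative associative operation on $Q$ with unit $1$ that distributes over arbitrary joins. Its implication $\to$ is defined by $p\&q\le r\iff q\le p\to r$. A $\mathcal{Q}$-ordered set is a set $A$ with a map $A(-,-):A\times A\to Q$ such that $A(x,x)=1$ and $A(y,z)\&A(x,y)\le A(x,z)$ for all $x,y,z\in A$. A map $f:A\to B$ is $\mathcal{Q}$-order preserving if $A(x,y)\le B(f(x),f(y))$ for all $x,y$. A fuzzy lower set of $A$ is a map $\phi:A\to Q$ with $\phi(y)\&A(x,y)\le\phi(x)$; a fuzzy upper set is a map $\psi:A\to Q$ with $A(x,y)\&\psi(x)\le\psi(y)$. $\mathrm{sub}_A(\phi_1,\phi_2)=\bigwedge_{x\in A}(\phi_1(x)\to\phi_2(x))$, and $\phi\otimes\psi=\bigvee_{x\in A}\phi(x)\&\psi(x)$ for $\phi$ a fuzzy lower and $\psi$ a fuzzy upper set. A fuzzy lower set $\phi$ is a flat ideal if $\bigvee_{x\in A}\phi(x)=1$ and $\phi\otimes(\psi_1\wedge\psi_2)=(\phi\otimes\psi_1)\wedge(\phi\otimes\psi_2)$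 for all fuzzy upper sets $\psi_1,\psi_2$ of $A$ (meets pointwise). For $f:A\to B$ $\mathcal{Q}$-order preserving and $\phi$ a fuzzy lower set of $A$, $f^{\to}(\phi)(y)=\bigvee_{x\in A}\phi(x)\&B(y,f(x))$. A class of weights $\Phi$ assigns to each $\mathcal{Q}$-ordered set $A$ a set $\Phi(A)$ of fuzzy lower sets of $A$ ($\mathcal{Q}$-ordered by $\mathrm{sub}_A$) such that $A(-,a)\in\Phi(A)$ for all $a\in A$, and $f^{\to}(\phi)\in\Phi(B)$ whenever $\phi\in\Phi(A)$ and $f:A\to B$ is $\mathcal{Q}$-order preserving. A supremum of a fuzzy lower set $\phi$ of $A$ is an element $\sup\phi\in A$ with $A(\sup\phi,x)=\mathrm{sub}_A(\phi,A(-,x))$ for all $x\in A$ (unique up to isomorphism, where $x,y$ are isomorphic if $A(x,y)=A(y,x)=1$). A $\mathcal{Q}$-order preserving map $f:A\to B$ is $\Phi$-cocontinuous if, for all $\phi\in\Phi(A)$, whenever $\sup\phi$ exists, $f(\sup\phi)$ is a supremum of $f^{\to}(\phi)$. A map $\psi:A\to Q$ is $\Phi$-open if it is a fuzzy upper set and $\psi(\sup\phi)\le\phi\otimes\psi$ for all $\phi\in\Phi(A)$ for which $\sup\phi$ exists. $\sigma_\Phi(A)$ denotes the set of $\Phi$-open fuzzy sets of $A$; when $\Phi$ is a subclass of flat ideals it is a stratified $\mathcal{Q}$-topology on $A$ (i.e. a subset of $Q^A$ containing all constants and closed under binary meets, arbitrary joins, and $\lambda\mapsto p\&\lambda$ for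 $p\in Q$). A map $f:(X,\tau)\to(Y,\tau')$ between $\mathcal{Q}$-topological spaces is continuous if $\lambda\circ f\in\tau$ for all $\lambda\in\tau'$. *)

(* Defs.v *)
From HB Require Import structures.
From mathcomp Require Import all_boot all_order.
From mathcomp Require Import boolp classical_sets.

Set Implicit Arguments.
Unset Strict Implicit.
Unset Printing Implicit Defensive.

Import Order.TTheory.

Local Open Scope order_scope.
Local Open Scope classical_set_scope.

Declare Scope quantale_scope.
Delimit Scope quantale_scope with Qt.
Local Open Scope quantale_scope.

(** The meets of arbitrary families need no separate field: see [qmeet]. The
    degenerate case [\bot = \top] is allowed. *)
HB.mixin Record isCompleteLattice d (T : Type) of Order.TBLattice d T := {
  qjoin : set T -> T;
  qjoin_isLub : forall S : set T, isLub S (qjoin S)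
}.

#[short(type="completeLatticeType")]
HB.structure Definition CompleteLattice d :=
  { T of Order.TBLattice d T & isCompleteLattice d T }.

HB.mixin Record isQuantale d (T : Type) of CompleteLattice d T := {
  qmul : T -> T -> T;
  qmulA : associative qmul;
  qmulC : commutative qmul;
  qmul1q : left_id \top qmul;
  qmul_joinr : forall (p : T) (S : set T),
    qmul p (qjoin S) = qjoin [set qmul p q | q in S]
}.

#[short(type="quantaleType")]
HB.structure Definition Quantale d :=
  { T of CompleteLattice d T & isQuantale d T }.

Infix "&*" := qmul (at level 40, left associativity) : quantale_scope.

Section CompleteLatticeTheory.
Context {d : Order.disp_t} {T : completeLatticeType d}.
Implicit Types (S : set T) (x : T).

Definition qmeet S : T := qjoin (lbound S).

Lemma le_qjoin S x : S x -> x <= qjoin S.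
Proof. by move=> Sx; have [+ _] := qjoin_isLub S; apply. Qed.

Lemma qjoin_le S x : (forall y, S y -> y <= x) -> qjoin S <= x.
Proof. by move=> ubx; have [_] := qjoin_isLub S; apply=> y /ubx. Qed.

Lemma qmeet_le S x : S x -> qmeet S <= x.
Proof. by move=> Sx; apply: qjoin_le => y /(_ x Sx). Qed.

Lemma le_qmeet S x : (forall y, S y -> x <= y) -> x <= qmeet S.
Proof. by move=> lbx; apply: le_qjoin => y /lbx. Qed.

End CompleteLatticeTheory.

Section QuantaleTheory.
Context {d : Order.disp_t} {Q : quantaleType d}.
Implicit Types p q r : Q.

Definition qimp p r : Q := qjoin [set q | p &* q <= r].

Lemma qmul_le2l p q r : q <= r -> p &* q <= p &* r.
Proof.
move=> qr; have -> : r = qjoin [set q; r].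
  apply/le_anti/andP; split; first by apply: le_qjoin; right.
  by apply: qjoin_le => _ [] ->.
by rewrite qmul_joinr; apply: le_qjoin; exists q => //; left.
Qed.

Lemma qimpP p q r : (p &* q <= r) = (q <= qimp p r).
Proof.
apply/idP/idP => [|qpr]; first exact: le_qjoin.
apply: le_trans (qmul_le2l p qpr) _.
by rewrite qmul_joinr; apply: qjoin_le => _ [s /= ? <-].
Qed.

End QuantaleTheory.

HB.mixin Record isQOrdered d (Q : quantaleType d) (A : Type) := {
  qhom : A -> A -> Q;
  qhom_refl : forall x, qhom x x = \top;
  qhom_trans : forall x y z, qhom y z &* qhom x y <= qhom x z
}.

#[short(type="qordType")]
HB.structure Definition QOrdered d (Q : quantaleType d) :=
  { A of isQOrdered d Q A }.

Section FuzzySets.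
Context {d : Order.disp_t} {Q : quantaleType d}.
Implicit Types A B : qordType Q.

Definition qord_preserving A B (f : A -> B) : Prop :=
  forall x y, qhom x y <= qhom (f x) (f y).

Definition fuzzy_lower A (phi : A -> Q) : Prop :=
  forall x y, phi y &* qhom x y <= phi x.

Definition fuzzy_upper A (psi : A -> Q) : Prop :=
  forall x y, qhom x y &* psi x <= psi y.

Definition qsub A (phi1 phi2 : A -> Q) : Q :=
  qmeet (range (fun x => qimp (phi1 x) (phi2 x))).

Definition qtensor A (phi psi : A -> Q) : Q :=
  qjoin (range (fun x => phi x &* psi x)).

Definition flat_ideal A (phi : A -> Q) : Prop :=
  [/\ fuzzy_lower phi,
      qjoin (range phi) = \top &
      forall psi1 psi2 : A -> Q, fuzzy_upper psi1 -> fuzzy_upper psi2 ->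
        qtensor phi (fun x => Order.meet (psi1 x) (psi2 x)) =
        Order.meet (qtensor phi psi1) (qtensor phi psi2)].

Definition qimage A B (f : A -> B) (phi : A -> Q) : B -> Q :=
  fun y => qjoin (range (fun x => phi x &* qhom y (f x))).

(** Suprema are only unique up to isomorphism, hence a predicate. *)
Definition is_qsup A (phi : A -> Q) (s : A) : Prop :=
  forall x : A, qhom s x = qsub phi (fun y => qhom y x).

End FuzzySets.

Record weight_class d (Q : quantaleType d) := WeightClass {
  weights :> forall A : qordType Q, set (A -> Q);
  weights_lower : forall (A : qordType Q) (phi : A -> Q),
    weights phi -> fuzzy_lower phi;
  weights_repr : forall (A : qordType Q) (a : A),
    weights (fun x : A => qhom x a);
  weights_image : forall (A B : qordType Q) (f : A -> B) (phi : A -> Q),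
    qord_preserving f -> weights phi -> weights (qimage f phi)
}.

Section PhiNotions.
Context {d : Order.disp_t} {Q : quantaleType d}.
Variable Phi : weight_class Q.
Implicit Types A B : qordType Q.

Definition flat_class : Prop :=
  forall A (phi : A -> Q), Phi A phi -> flat_ideal phi.

Definition cocontinuous A B (f : A -> B) : Prop :=
  qord_preserving f /\
  forall (phi : A -> Q) (s : A),
    Phi A phi -> is_qsup phi s -> is_qsup (qimage f phi) (f s).

Definition qopen A (psi : A -> Q) : Prop :=
  fuzzy_upper psi /\
  forall (phi : A -> Q) (s : A),
    Phi A phi -> is_qsup phi s -> psi s <= qtensor phi psi.

End PhiNotions.

Record qtopology d (Q : quantaleType d) (X : Type) := QTopology {
  qopens : set (X -> Q);
  qopens_cst : forall p : Q, qopens (fun=> p);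
  qopens_meet : forall l1 l2 : X -> Q, qopens l1 -> qopens l2 ->
    qopens (fun x => Order.meet (l1 x) (l2 x));
  qopens_join : forall L : set (X -> Q), L `<=` qopens ->
    qopens (fun x => qjoin [set l x | l in L]);
  qopens_mul : forall (p : Q) (l : X -> Q), qopens l ->
    qopens (fun x => p &* l x)
}.

Definition qcontinuous d (Q : quantaleType d) (X Y : Type)
    (tau : qtopology Q X) (tau' : qtopology Q Y) (f : X -> Y) : Prop :=
  forall l : Y -> Q, qopens tau' l -> qopens tau (l \o f).

Section Sigma.
Context {d : Order.disp_t} {Q : quantaleType d} {Phi : weight_class Q}.
Hypothesis flatPhi : flat_class Phi.
Variable A : qordType Q.
Implicit Types (p : Q) (l : A -> Q).

Lemma qopen_cst p : qopen Phi (fun _ : A => p).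
Proof.
split=> [x y|phi s Phiphi _].
  by rewrite -[leRHS]qmul1q qmulC [leRHS]qmulC qmul_le2l // lex1.
have [_ phi1 _] := flatPhi Phiphi.
rewrite -[leLHS]qmul1q -phi1 qmulC qmul_joinr; apply: qjoin_le.
by move=> _ [_ [x _ <-] <-]; apply: le_qjoin; exists x; rewrite // qmulC.
Qed.

Lemma qopen_meet l1 l2 : qopen Phi l1 -> qopen Phi l2 ->
  qopen Phi (fun x => Order.meet (l1 x) (l2 x)).
Proof.
move=> [u1 o1] [u2 o2]; split=> [x y|phi s Phiphi sups].
  rewrite lexI; apply/andP; split.
    by apply: le_trans (u1 x y); apply: qmul_le2l; exact: leIl.
  by apply: le_trans (u2 x y); apply: qmul_le2l; exact: leIr.
have [_ _ ->//] := flatPhi Phiphi.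
by apply: leI2; [exact: o1|exact: o2].
Qed.

Lemma qopen_join (L : set (A -> Q)) : L `<=` qopen Phi (A := A) ->
  qopen Phi (fun x => qjoin [set l x | l in L]).
Proof.
move=> Lo; split=> [x y|phi s Phiphi sups].
  rewrite qmul_joinr; apply: qjoin_le => _ [_ [l Ll <-] <-].
  by have [/(_ x y) u _] := Lo _ Ll; apply: le_trans u (le_qjoin _); exists l.
apply: qjoin_le => _ [l Ll <-]; have [_ o] := Lo _ Ll.
apply: le_trans (o _ _ Phiphi sups) _; apply: qjoin_le => _ [x _ <-].
apply: (@le_trans _ _ (phi x &* qjoin [set l' x | l' in L])).
  by apply/qmul_le2l/le_qjoin; exists l.
by apply: le_qjoin; exists x.
Qed.

Lemma qopen_mul p l : qopen Phi l -> qopen Phi (fun x => p &* l x).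
Proof.
move=> [u o]; split=> [x y|phi s Phiphi sups].
  by rewrite qmulA (qmulC (qhom x y)) -qmulA qmul_le2l.
apply: le_trans (qmul_le2l _ (o _ _ Phiphi sups)) _.
rewrite qmul_joinr; apply: qjoin_le => _ [_ [x _ <-] <-].
by apply: le_qjoin; exists x; rewrite // !qmulA (qmulC p).
Qed.

Definition sigma : qtopology Q A :=
  @QTopology d Q A (qopen Phi (A := A))
    qopen_cst qopen_meet qopen_join qopen_mul.

End Sigma.

(* Main.v *)
Require Import Defs.
From mathcomp Require Import all_boot all_order.
From mathcomp Require Import boolp classical_sets.

(** Openness of [l \o f] is tested on a weight [phi] with supremum [s]. Since
    [f] is cocontinuous, [f s] is a supremum of the direct image
    [qimage f phi], which is again a weight, so openness of [l] bounds
    [l (f s)] by the tensor of that image with [l]. Everything therefore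
    reduces to moving [f] across the tensor ([qtensor_image_le]). The image is
    the extension of [phi] along the representables [qhom - (f x)], and
    tensoring a representable with an upper set [psi] gives at most the value
    of [psi] at the representing point (the easy half of the Yoneda lemma). *)

Import Order.TTheory.
Local Open Scope order_scope.
Local Open Scope quantale_scope.

Lemma qmul_le2r d (Q : quantaleType d) (p q r : Q) :
  q <= r -> q &* p <= r &* p.
Proof. by move=> qr; rewrite ![_ &* p]qmulC qmul_le2l. Qed.

(** Inequality half of the projection formula for direct images: once the join
    defining the image is distributed over [&*], each term
    [phi x &* qhom y (f x) &* psi y] is bounded by [phi x &* psi (f x)], because an
    upper set transports its value from [y] to [f x]. *)
Lemma qtensor_image_le d (Q : quantaleType d) (A B : qordType Q) (f : A -> B)
    (phi : A -> Q) (psi : B -> Q) : fuzzy_upper psi ->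
  qtensor (qimage f phi) psi <= qtensor phi (psi \o f).
Proof.
move=> upsi; apply: qjoin_le => _ [y _ <-].
rewrite qmulC qmul_joinr; apply: qjoin_le => _ [_ [x _ <-] <-].
rewrite qmulC -qmulA; apply: le_trans (qmul_le2l _ (upsi y (f x))) _.
by apply: le_qjoin; exists x.
Qed.

Lemma fuzzy_upper_comp d (Q : quantaleType d) (A B : qordType Q) (f : A -> B)
    (psi : B -> Q) :
  qord_preserving f -> fuzzy_upper psi -> fuzzy_upper (psi \o f).
Proof.
move=> fmono upsi x y.
by apply: le_trans (upsi (f x) (f y)); apply/qmul_le2r/fmono.
Qed.

Theorem proposition5p6 (d : Order.disp_t) (Q : quantaleType d)
    (Phi : weight_class Q) (flatPhi : flat_class Phi)
    (A B : qordType Q) (f : A -> B) (hf : cocontinuous Phi f) :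
  qcontinuous (sigma flatPhi A) (sigma flatPhi B) f.
Proof.
case: hf => fmono fsup l [ul ol].
split=> [|phi s Phiphi sups]; first exact: fuzzy_upper_comp.
apply: le_trans (qtensor_image_le _ _ _ _ _ _ _ ul).
exact: ol (weights_image fmono Phiphi) (fsup _ _ Phiphi sups).
Qed.
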